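(* Let $n=r+1$ and let $(H_S^{-1})_{1\beta}$ denote the $(1,\beta)$ block (of size $r\times r$) of the inverse of the matrix $H_S$. For each $\beta=2,\dots,r$, $$2(H_S^{-1})_{1\beta}=\sum_{i=1}^{r-\beta+1}E_{i,i+\beta-1}-\sum_{i=1}^{\beta-1}E_{r-\beta+i+1,i}-\sum_{i=1}^{r-\beta+2}E_{i,i+\beta-2}+\sum_{i=1}^{\beta-2}E_{r-\beta+i+2,i}.$$
   Context: $E_{ij}$ are the $r\times r$ matrix units. $N_r$ is the $r\times r$ matrix with all entries on and above the diagonal equal to $-1$ and zeros below the diagonal; $M_r=-N_r^t$. $H_S$ is the $nr\times nr$ matrix consisting of $n\times n$ blocks of size $r\times r$ with diagonal blocks $-(M_r+N_r)$, all blocks above the diagonal equal to the identity $\mathbb I$ and all blocks below the diagonal equal to $-\mathbb I$. For $n=r+1$ it is invertible. *)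

(* Defs.v *)
From mathcomp Require Import all_boot all_order all_algebra.

Set Implicit Arguments.
Unset Strict Implicit.
Unset Printing Implicit Defensive.

Import GRing.Theory Num.Theory.
Local Open Scope ring_scope.

Section Defs.

Variable K : numFieldType.

(* Rows and columns are numbered from 1; the matrix is 0 if an index is not in
   1, ..., r. *)
Definition munit (r i j : nat) : 'M[K]_r :=
  \matrix_(k < r, l < r) ((k.+1 == i) && (l.+1 == j))%:R.

Lemma munitE (r : nat) (k l : 'I_r) : munit r k.+1 l.+1 = delta_mx k l.
Proof. by apply/matrixP => a b; rewrite !mxE !eqSS -!val_eqE. Qed.

Definition Nmx (r : nat) : 'M[K]_r :=
  \matrix_(i < r, j < r) (if (i <= j)%N then -1 else 0).

Definition Mmx (r : nat) : 'M[K]_r := - (Nmx r)^T.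

Definition HS (n r : nat) : 'M[K]_(\sum_(a < n) r) :=
  \mxblock_(a < n, b < n)
    (if a == b then - (Mmx r + Nmx r)
     else if (a < b)%N then 1%:M else - 1%:M).

(* The (a, b) block of size r x r, with block indices numbered from 1:
   meaningful for 1 <= a, b <= n + 1. *)
Definition block (n r : nat) (A : 'M[K]_(\sum_(c < n.+1) r)) (a b : nat) :
  'M[K]_r :=
  @submxblock K n.+1 n.+1 (fun=> r) (fun=> r) A (inord a.-1) (inord b.-1).

End Defs.

(* Main.v *)
Require Import Defs.
From mathcomp Require Import all_boot all_order all_algebra.
From mathcomp Require Import zify ring.

(* Let [u] be the r x r antiperiodic shift ([u ^ r = -1]) and [t] its n x n
   analogue. The diagonal block of [H_S] is [(1 + u) / (1 - u)], and the sign
   pattern of its off-diagonal blocks is [(1 + t) / (1 - t)], so that [H_S] is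
   [2 (1 - tu) / ((1 - t) (1 - u))]. For n = r + 1 one has
   [(1 - tu) (sum_(a < n) (tu)^a) = 1 - t^n u^n = 1 - u], whence
   [2 H_S^-1 = (1 - t) (sum_(a < n) (tu)^a)], whose (1, beta) block is
   [u^(beta - 1) - u^(beta - 2)] for beta >= 2. *)

Import GRing.Theory Num.Theory.
Local Open Scope ring_scope.

(* [u ^ k], for [k <= r]. *)
Definition antishift (K : numFieldType) (r k : nat) : 'M[K]_r :=
  \matrix_(i < r, j < r) ((i + k == j)%N%:R - (i + k == j + r)%N%:R).

(* This is [- u ^ (c - b)] if [b <= c], and [- u ^ (c + 1 - b)] otherwise, the
   negative exponents being removed by [u ^ r = -1]. Its increments in [b] are
   the (b, c) blocks of [2 H_S^-1] (indices from 0), so that the off-diagonal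
   part of the product with [H_S] telescopes. *)
Definition potential (K : numFieldType) (r c b : nat) : 'M[K]_r :=
  if (b <= c)%N then - antishift K r (c - b) else antishift K r (r.+1 + c - b).

Lemma antishift0 (K : numFieldType) (r : nat) : antishift K r 0 = 1%:M.
Proof.
apply/matrixP => i j; rewrite !mxE addn0 -val_eqE.
suff -> : (i == j + r :> nat)%N = false by rewrite subr0.
by have := ltn_ord i; lia.
Qed.

Lemma antishift_size (K : numFieldType) (r : nat) : antishift K r r = - 1%:M.
Proof.
apply/matrixP => i j; rewrite !mxE eqn_add2r -val_eqE.
suff -> : (i + r == j :> nat)%N = false by rewrite sub0r.
by have := ltn_ord j; lia.
Qed.

Lemma diag_blockE (K : numFieldType) (r : nat) (i j : 'I_r) :
  (- (Mmx K r + Nmx K r)) i j = (i < j)%N%:R - (j < i)%N%:R.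
Proof.
rewrite !mxE opprD opprK.
by case: (ltngtP i j) => _ /=; ring.
Qed.

Lemma sum_mul_delta (K : numFieldType) (r m : nat) (F : nat -> K) :
  \sum_(j < r) F j * (j == m :> nat)%:R = if (m < r)%N then F m else 0.
Proof.
case: ltnP => [lt_mr | le_rm].
  rewrite (bigD1 (Ordinal lt_mr)) //= eqxx mulr1 big1 ?addr0 // => j.
  by rewrite -val_eqE /= => /negbTE ->; rewrite mulr0.
rewrite big1 // => j _; suff -> : (j == m :> nat) = false by rewrite mulr0.
by have := ltn_ord j; lia.
Qed.

(** Column [l] of [u ^ k] has a single nonzero entry: 1 in row [l - k], or, after wrapping around,
    -1 in row [l + r - k]. The product thus reads off one entry of the diagonal block, up to
    sign. *)
Lemma diag_block_antishift (K : numFieldType) (r k : nat) (i l : 'I_r) :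
  (k <= r)%N ->
  (- (Mmx K r + Nmx K r) *m antishift K r k) i l =
    if (k <= l)%N then (i + k < l)%N%:R - (l < i + k)%N%:R
    else (l + r < i + k)%N%:R - (i + k < l + r)%N%:R.
Proof.
move=> le_kr; rewrite mxE; have lt_lr := ltn_ord l.
pose s (j : nat) : K := (i < j)%N%:R - (j < i)%N%:R.
case: (leqP k l) => [le_kl | lt_lk].
  transitivity (\sum_(j < r) s j * (j == (l - k)%N :> nat)%:R).
    apply: eq_bigr => j _; rewrite diag_blockE mxE -/(s j); have := ltn_ord j.
    move=> lt_jr; have -> : (j + k == l + r)%N = false by lia.
    have -> : (j + k == l)%N = (j == (l - k)%N :> nat) by lia.
    by rewrite subr0.
  rewrite sum_mul_delta; have -> : (l - k < r)%N by lia.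
  by rewrite /s; congr (_%:R - _%:R); lia.
transitivity (- \sum_(j < r) s j * (j == (l + r - k)%N :> nat)%:R).
  rewrite -sumrN; apply: eq_bigr => j _; rewrite diag_blockE mxE -/(s j).
  have -> : (j + k == l)%N = false by lia.
  have -> : (j + k == l + r)%N = (j == (l + r - k)%N :> nat) by lia.
  by rewrite sub0r mulrN.
rewrite sum_mul_delta; have -> : (l + r - k < r)%N by lia.
by rewrite /s opprB; congr (_%:R - _%:R); lia.
Qed.

(* [D (1 - u) = 1 + u] for the diagonal block [D], multiplied by [u ^ k]. *)
Lemma diag_block_Cayley (K : numFieldType) (r k : nat) : (k < r)%N ->
  - (Mmx K r + Nmx K r) *m (antishift K r k - antishift K r k.+1) =
    antishift K r k + antishift K r k.+1.
Proof.
move=> lt_kr; apply/matrixP => i l; rewrite mulmxBr mxE [in X in _ + X]mxE.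
rewrite !diag_block_antishift ?(ltnW lt_kr) // !mxE.
have lt_lr := ltn_ord l; have lt_ir := ltn_ord i.
have z (b : bool) : b = false -> (b%:R : K) = 0 by move->.
(* In column [l], neither power has wrapped around if [k < l], both have if [l < k], and only
   [u ^ k.+1] has if [k = l]. *)
case: (ltngtP k l) => [lt_kl | lt_lk | eq_kl].
- rewrite (z (i + k == l + r)%N) ?(z (i + k.+1 == l + r)%N); [|lia..].
  case: (ltngtP (i + k)%N l) => e1; case: (ltngtP (i + k.+1)%N l) => e2;
    rewrite /=; try lia; ring.
- rewrite (z (i + k == l)%N) ?(z (i + k.+1 == l)%N); [|lia..].
  case: (ltngtP (i + k)%N (l + r)%N) => e1;
  case: (ltngtP (i + k.+1)%N (l + r)%N) => e2;
    rewrite /=; try lia; ring.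
- rewrite (z (i + k < l)%N) ?(z (i + k.+1 == l)%N) ?(z (i + k == l + r)%N)
    ?(z (l + r < i + k.+1)%N); [|lia..].
  case: (ltngtP (i + k)%N l) => e1;
  case: (ltngtP (i + k.+1)%N (l + r)%N) => e2;
    rewrite /=; try lia; ring.
Qed.

Lemma mul_HS (K : numFieldType) (r : nat) :
  HS K r.+1 r *m
    \mxblock_(a < r.+1, c < r.+1)
      (potential K r c a.+1 - potential K r c a) = 2%:R%:M.
Proof.
rewrite /HS mul_mxblock -[RHS]mxdiagZ /mxdiag; apply: eq_mxblock => a c.
set p := potential K r c.
have lt_ar := ltn_ord a; have lt_cr := ltn_ord c.
have above : \sum_(b < r.+1 | (a < b)%N) (p b.+1 - p b) = p r.+1 - p a.+1.
  rewrite -(@telescope_sumr _ a.+1 r.+1) // (big_nat_widenl _ 0%N) //.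
  by rewrite big_mkord; apply: eq_bigl.
have below : \sum_(b < r.+1 | (b < a)%N) (p b.+1 - p b) = p a - p 0%N.
  rewrite -(@telescope_sumr _ 0 a) //.
  rewrite -(big_mkord (fun b => b < a)%N (fun b => p b.+1 - p b)).
  by rewrite (big_nat_widen 0 a r.+1) // ltnW.
(* The choice n = r + 1 enters here: the two ends of the telescope are [u ^ c] and [- u ^ c]. *)
have ends : p r.+1 + p 0%N = 0.
  rewrite /p /potential leq0n subn0 ifF; last by lia.
  by rewrite addKn subrr.
rewrite (bigD1 a) //= eqxx.
have -> : \sum_(b < r.+1 | b != a)
   (if a == b then - (Mmx K r + Nmx K r)
    else if (a < b)%N then 1%:M else - 1%:M) *m (p b.+1 - p b)
  = p r.+1 - p a.+1 - (p a - p 0%N).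
  rewrite -above -below (bigID (fun b : 'I_r.+1 => (a < b)%N)) /=.
  congr (_ + _).
    apply: eq_big => b; rewrite -val_eqE /=; first lia.
    by move=> /andP[/negbTE ne lt]; rewrite -val_eqE /= eq_sym ne lt mul1mx.
  rewrite -sumrN; apply: eq_big => b; rewrite -!val_eqE /=; first lia.
  move=> /andP[/negbTE ne /negbTE nlt].
  by rewrite eq_sym ne nlt mulNmx mul1mx.
have -> : p r.+1 - p a.+1 - (p a - p 0%N) = - (p a + p a.+1).
  by rewrite opprB addrACA ends add0r -opprD addrC.
(* Off the diagonal, [p a] and [p a.+1] are consecutive powers of [u] with a common sign, so the
   Cayley relation cancels the telescoped term. At [a = c] the potential changes branch and both
   values are -1, since [u ^ r = -1]: the diagonal block is multiplied by 0 and 2 remains. *)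
case: (ltngtP a c) => [lt_ac | lt_ca | /val_inj eq_ac].
- rewrite -val_eqE /= ltn_eqF //.
  have pa : p a = - antishift K r (c - a.+1).+1.
    by rewrite /p /potential (ltnW lt_ac) subnSK.
  have pa1 : p a.+1 = - antishift K r (c - a.+1) by rewrite /p /potential lt_ac.
  have -> : p a + p a.+1 =
      - (antishift K r (c - a.+1) + antishift K r (c - a.+1).+1).
    by rewrite pa pa1 opprD addrC.
  have -> : p a.+1 - p a =
      - (antishift K r (c - a.+1) - antishift K r (c - a.+1).+1).
    by rewrite pa pa1 opprK opprB addrC.
  by rewrite mulmxN diag_block_Cayley ?opprK ?addNr //; lia.
- rewrite -val_eqE /= gtn_eqF //.
  have pa : p a = antishift K r (r + c - a).+1.
    by rewrite /p /potential leqNgt lt_ca addSn subSn //; lia.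
  have pa1 : p a.+1 = antishift K r (r + c - a).
    by rewrite /p /potential ltnNge (ltnW lt_ca) addSn subSS.
  rewrite pa pa1 diag_block_Cayley ?(addrC (antishift K r _.+1)) ?subrr //.
  by lia.
have pa : p a = - 1%:M by rewrite /p eq_ac /potential leqnn subnn antishift0.
have pa1 : p a.+1 = - 1%:M.
  by rewrite /p eq_ac /potential ltnn addSn subSS addnK antishift_size.
rewrite pa pa1 subrr mulmx0 add0r -opprD opprK eq_ac eqxx conform_mx_id.
exact/esym/(raddfD scalar_mx).
Qed.

Lemma invmx_HS (K : numFieldType) (r : nat) :
  2%:R *: invmx (HS K r.+1 r) =
    \mxblock_(a < r.+1, c < r.+1)
      (potential K r c a.+1 - potential K r c a).
Proof.
have nz2 : (2%:R : K) != 0 by rewrite pnatr_eq0.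
set W := \mxblock_(a, c) _.
(* A right inverse of a square matrix proves it invertible; on a singular matrix [invmx] would be
   the identity function. *)
have HW1 : HS K r.+1 r *m (2%:R^-1 *: W) = 1%:M.
  by rewrite -scalemxAr mul_HS scale_scalar_mx mulVf.
have [HS_unit _] := mulmx1_unit HW1.
by rewrite -[RHS](mulKmx HS_unit) mul_HS mul_mx_scalar.
Qed.

(** The first sum is the [k]-th superdiagonal, the second the wrapped-around entries in the lower
    left corner. *)
Lemma sum_munit_antishift (K : numFieldType) (r k : nat) : (k <= r)%N ->
  \sum_(1 <= m < (r - k).+1) munit K r m (m + k)
  - \sum_(1 <= m < k.+1) munit K r (r - k + m) m = antishift K r k.
Proof.
move=> le_kr; apply/matrixP => i j; rewrite !mxE !summxE.
have lt_ir := ltn_ord i; have lt_jr := ltn_ord j.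
congr (_ - _); rewrite big_add1 /= big_mkord.
  transitivity (\sum_(m < r - k) (i + k == j)%N%:R * (m == i :> nat)%:R : K).
    apply: eq_bigr => m _; rewrite mxE -natrM mulnb; congr (_%:R); lia.
  rewrite (@sum_mul_delta _ _ _ (fun=> _)); case: ltnP => // le_i.
  by have -> : (i + k == j)%N = false by lia.
transitivity (\sum_(m < k) (i + k == j + r)%N%:R * (m == j :> nat)%:R : K).
  apply: eq_bigr => m _; rewrite mxE -natrM mulnb; congr (_%:R); lia.
rewrite (@sum_mul_delta _ _ _ (fun=> _)); case: ltnP => // le_j.
by have -> : (i + k == j + r)%N = false by lia.
Qed.

Theorem proposition3p19 (K : numFieldType) (r beta : nat)
    (hbeta : (2 <= beta <= r)%N) :
  2%:R *: block (invmx (HS K r.+1 r)) 1 beta =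
    \sum_(1 <= i < (r - beta + 1).+1) munit K r i (i + beta - 1)
    - \sum_(1 <= i < (beta - 1).+1) munit K r (r - beta + i + 1) i
    - \sum_(1 <= i < (r - beta + 2).+1) munit K r i (i + beta - 2)
    + \sum_(1 <= i < (beta - 2).+1) munit K r (r - beta + i + 2) i.
Proof.
have -> : 2%:R *: block (invmx (HS K r.+1 r)) 1 beta =
    block (2%:R *: invmx (HS K r.+1 r)) 1 beta.
  by apply/matrixP => i j; rewrite !mxE.
have [le2b ler] := andP hbeta.
rewrite invmx_HS /block mxblockK /potential !inordK //=; last lia.
(* As [beta >= 2], both potentials, at 1 and at 0, lie in the first branch, and the block is
   [u ^ (beta - 1) - u ^ (beta - 2)]. *)
have -> : (0 < beta.-1)%N by lia.
rewrite opprK addrC subn0 subn1.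
rewrite -!sum_munit_antishift; try lia.
rewrite opprB [\sum_(1 <= m < beta.-2.+1) _ - _]addrC addrA.
congr (_ - _ - _ + _); apply: congr_big_nat => // [|m _];
  by [lia | congr munit; lia].
Qed.
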